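(* Let us assume that the sequences $\{s_n\}$ and $\{\omega_n\}$ satisfy the following: (S-0) the elements of $\{s_n\}$ are the partial sums of an infinite series which either converges to some limit $s$ or in the case of divergence can be summed to give $s$; (S-1) the elements of the sequence $\{\omega_n\}$ of (nonzero) remainder estimates for $\{s_n\}$ are strictly alternating in sign; and for all $n\in\mathbb N_0$ the ratio $(s_n-s)/\omega_n$ can be expressed as a series in inverse powers of $\beta+n$, $$\frac{s_n-s}{\omega_n}=\sum_{j=0}^{\infty}\frac{c'_j}{(\beta+n)^j},\qquad \beta\in\mathbb R,\ \beta>0,\quad n\in\mathbb N_0.$$ Let Levin's sequence transformation $\mathcal L_k^{(n)}(\beta,s_n,\omega_n)$ be used for the transformation of $\{s_n\}$. Then for large values of $n$ and for fixed $k\in\mathbb N$ the following order estimate holds: $$\frac{\mathcal L_k^{(n)}(\beta,s_n,\omega_n)-s}{s_n-s}=O(n^{-2k}),\qquad n\to\infty.$$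
   Context: The forward difference operator is $\Delta f(n)=f(n+1)-f(n)$ and acts on $n$ only. Levin's sequence transformation is $$\mathcal L_k^{(n)}(\beta,s_n,\omega_n)=\frac{\Delta^k\{(\beta+n)^{k-1}\,s_n/\omega_n\}}{\Delta^k\{(\beta+n)^{k-1}/\omega_n\}}=\frac{\sum_{j=0}^k(-1)^j\binom kj\frac{(\beta+n+j)^{k-1}}{(\beta+n+k)^{k-1}}\frac{s_{n+j}}{\omega_{n+j}}}{\sum_{j=0}^k(-1)^j\binom kj\frac{(\beta+n+j)^{k-1}}{(\beta+n+k)^{k-1}}\frac{1}{\omega_{n+j}}}.$$ In the divergent case $s$ is called the antilimit of the sequence.
   Formalization: The formal theorem additionally assumes c'_0 ≠ 0; without it the claim fails, e.g. k=1, β=1, s=0, ω_n=(−1)^n, s_n=(−1)^n/(n+1), where the ratio is 1/(2(n+2)). *)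

(* Defs.v *)
From HB Require Import structures.
From mathcomp Require Import all_boot all_order all_algebra.
From mathcomp Require Import all_classical all_reals all_analysis.
Import Order.TTheory GRing.Theory Num.Theory.
Import numFieldNormedType.Exports.
Set Implicit Arguments.
Unset Strict Implicit.
Unset Printing Implicit Defensive.

Local Open Scope classical_set_scope.
Local Open Scope ring_scope.

Definition fdiff (V : zmodType) (f : nat -> V) (n : nat) : V := f n.+1 - f n.

(* The exponent k - 1 is taken in int, so that it is -1 when k = 0. *)
Definition levin (R : realType) (k n : nat) (beta : R) (s_ w : R^nat) : R :=
  iter k (@fdiff R)
    (fun m => (beta + m%:R) ^ (k%:Z - 1) * s_ m / w m) n /
  iter k (@fdiff R)
    (fun m => (beta + m%:R) ^ (k%:Z - 1) / w m) n.

(* To be used with a sequence of nonzero terms (sg 0 = 0). *)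
Definition strictly_alternating (R : realType) (w : R^nat) : Prop :=
  forall n, Num.sg (w n.+1) = - Num.sg (w n).

(* [summed_to a s] reads "the series of general term a is summed to s" by
   whatever summation method is in use; in the divergent case s is then the
   antilimit of the partial sums. *)
Definition limit_or_antilimit (R : realType)
    (summed_to : R^nat -> R -> Prop) (a : R^nat) (s : R) : Prop :=
  series a @ \oo --> s \/ ~ cvgn (series a) /\ summed_to a s.

(* Main.v *)
(** Write [x = beta + n]. The error [levin k n beta s_ w - s] is the quotient of
    [Delta^k (x^(k-1) (s_n - s) / w_n)] by [Delta^k (x^(k-1) / w_n)].
    In the numerator the terms [c_j x^(k-1-j)] with [j < k] are polynomials of
    degree less than [k] and are annihilated; each of the terms [x^(-i)] with
    [1 <= i <= k] gains a factor [x^(-k)] under [Delta^k]; and what is left is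
    already [O(x^(-k-1))] before differencing. So no term-by-term
    differencing of the infinite series is needed, and the numerator is
    [O(x^(-k-1))]. In the denominator the alternating signs exclude any
    cancellation, so it is at least [x^(k-1) / |w_n|]. Finally
    [(s_n - s) / w_n] tends to [c_0 <> 0]. *)

Require Import Defs.
From mathcomp Require Import all_boot all_order all_algebra.
From mathcomp Require Import all_classical all_reals all_analysis.
From mathcomp Require Import ring lra zify.
Import Order.TTheory GRing.Theory Num.Theory.
Import numFieldNormedType.Exports.

Set Implicit Arguments.
Unset Strict Implicit.
Unset Printing Implicit Defensive.

Local Open Scope classical_set_scope.
Local Open Scope ring_scope.

(** * Iterated differences: linearity and annihilation of polynomials *)

Lemma iter_fdiffD (V : zmodType) (k : nat) (f g : nat -> V) (n : nat) :
  iter k (@fdiff V) (fun m => f m + g m) n =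
  iter k (@fdiff V) f n + iter k (@fdiff V) g n.
Proof.
elim: k n => //= k IH n.
by rewrite /fdiff !IH opprD addrACA.
Qed.

Lemma iter_fdiffZ (R : pzRingType) (k : nat) (a : R) (f : nat -> R) (n : nat) :
  iter k (@fdiff R) (fun m => a * f m) n = a * iter k (@fdiff R) f n.
Proof.
elim: k n => //= k IH n.
by rewrite /fdiff !IH mulrBr.
Qed.

Lemma iter_fdiff_sum (V : zmodType) (k N : nat) (F : nat -> nat -> V)
    (n : nat) :
  iter k (@fdiff V) (fun m => \sum_(j < N) F j m) n =
  \sum_(j < N) iter k (@fdiff V) (F j) n.
Proof.
elim: k n => //= k IH n.
by rewrite /fdiff !IH -sumrB.
Qed.

Lemma iter_fdiff_shift (V : zmodType) (k : nat) (f : nat -> V) (n : nat) :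
  iter k (@fdiff V) (fun m => f m.+1) n = iter k (@fdiff V) f n.+1.
Proof.
elim: k n => //= k IH n.
by rewrite /fdiff !IH.
Qed.

Lemma eq_iter_fdiff (V : zmodType) (k : nat) (f g : nat -> V) :
  f =1 g -> iter k (@fdiff V) f =1 iter k (@fdiff V) g.
Proof.
move=> fg; elim: k => //= k IH n.
by rewrite /fdiff !IH.
Qed.

Lemma fdiffM (R : pzRingType) (f g : nat -> R) (n : nat) :
  fdiff (fun m => f m * g m) n = fdiff f n * g n + f n.+1 * fdiff g n.
Proof. by rewrite /fdiff mulrBl mulrBr [RHS]addrC addrA subrK. Qed.

(** Since [beta + n] has difference 1, differencing [(beta + n) * f n] gives
    [(beta + n) * fdiff f n + f n.+1]. Induction on [k] applies to the first term, and the second is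
    killed by hypothesis. *)
Lemma iter_fdiff_shift_mul_eq0 (R : comPzRingType) (beta : R) (k : nat)
    (f : nat -> R) :
  (forall n, iter k (@fdiff R) f n = 0) ->
  forall n, iter k.+1 (@fdiff R) (fun m => (beta + m%:R) * f m) n = 0.
Proof.
elim: k f => [|k IH] f f0 n.
  have /= f0' := f0; by rewrite /= /fdiff !f0' !mulr0 subr0.
rewrite iterSr.
rewrite (@eq_iter_fdiff _ _ _ (fun m => (beta + m%:R) * fdiff f m + f m.+1)).
  rewrite iter_fdiffD iter_fdiff_shift f0 addr0 IH// => m.
  by rewrite -iterSr f0.
move=> m; rewrite /fdiff -(natr1 m); ring.
Qed.

Lemma iter_fdiff_exp_eq0 (R : comPzRingType) (beta : R) (k m n : nat) :
  (m < k)%N -> iter k (@fdiff R) (fun i => (beta + i%:R) ^+ m) n = 0.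
Proof.
elim: m k n => [|m IH] [|k] n //= mk.
  rewrite -iterS iterSr (@eq_iter_fdiff _ _ _ (fun=> 0 * 0)).
    by rewrite iter_fdiffZ mul0r.
  by move=> i; rewrite /fdiff !expr0 subrr mul0r.
rewrite -iterS (@eq_iter_fdiff _ _ _
  (fun i => (beta + i%:R) * (beta + i%:R) ^+ m)).
  by rewrite iter_fdiff_shift_mul_eq0// => i; rewrite IH.
by move=> i; rewrite exprS.
Qed.

(** * Differences of alternating sequences *)

(** Subtracting a neighbour of opposite sign adds moduli: the difference has modulus
    [|g n.+1| + |g n|] and the sign of [- g n]. *)
Lemma strictly_alternating_fdiff (R : realType) (g : R^nat) :
  strictly_alternating g ->
  strictly_alternating (fdiff g) /\ forall n, `|g n| <= `|fdiff g n|.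
Proof.
move=> ga.
have key n : fdiff g n = - Num.sg (g n) * (`|g n.+1| + `|g n|).
  rewrite /fdiff mulrDr -{1}ga -numEsg mulNr.
  by rewrite -numEsg.
have sgE n : Num.sg (fdiff g n) = - Num.sg (g n).
  rewrite key mulNr sgrN sgrM sgr_id; congr (- _).
  have [->|gn0] := eqVneq (g n) 0; first by rewrite sgr0 mul0r.
  by rewrite (gtr0_sg (x := _ + _)) ?mulr1// ltr_wpDl ?normr_gt0.
split=> n; first by rewrite !sgE ga.
rewrite key mulNr normrN normrM normr_sg.
have [->|gn0] := eqVneq (g n) 0; first by rewrite normr0 mul0r.
by rewrite mul1r ger0_norm ?addr_ge0// lerDr.
Qed.

(* All terms of the binomial sum of [iter k fdiff g n] have the same sign. *)
Lemma le_norm_iter_fdiff (R : realType) (g : R^nat) (k n : nat) :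
  strictly_alternating g -> `|g n| <= `|iter k (@fdiff R) g n|.
Proof.
move=> ga; suff [_ ->] : strictly_alternating (iter k (@fdiff R) g) /\
  forall m, `|g m| <= `|iter k (@fdiff R) g m| by [].
elim: k => [//|k [ka kle]] /=.
have [dka dkle] := strictly_alternating_fdiff ka.
by split=> // m; exact: le_trans (kle m) (dkle m).
Qed.

(** * Decay in powers of [beta + n], with and without gain under differencing *)

Definition decays (R : realType) (beta : R) (p : nat) (f : R^nat) : Prop :=
  exists2 C, 0 <= C & forall n, `|f n| <= C * (beta + n%:R) ^- p.

(** A discrete symbol class of order [-p]: every difference gains one power. *)
Definition diff_decays (R : realType) (beta : R) (p : nat) (f : R^nat) : Prop :=
  forall k, decays beta (p + k) (iter k (@fdiff R) f).

Lemma node_gt0 (R : realType) (beta : R) (n : nat) :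
  0 < beta -> 0 < beta + n%:R.
Proof. by move=> b0; rewrite ltr_wpDr. Qed.

Lemma eq_decays (R : realType) (beta : R) (p : nat) (f g : R^nat) :
  f =1 g -> decays beta p f -> decays beta p g.
Proof. by move=> fg [C C0 fC]; exists C => // n; rewrite -fg. Qed.

Lemma decaysD (R : realType) (beta : R) (p : nat) (f g : R^nat) :
  decays beta p f -> decays beta p g -> decays beta p (fun n => f n + g n).
Proof.
move=> [C C0 fC] [D D0 gD]; exists (C + D) => [|n]; first exact: addr_ge0.
by rewrite mulrDl; apply: le_trans (ler_normD _ _) _; exact: lerD.
Qed.

Lemma decaysM (R : realType) (beta : R) (p q : nat) (f g : R^nat) :
  decays beta p f -> decays beta q g ->
  decays beta (p + q) (fun n => f n * g n).
Proof.
move=> [C C0 fC] [D D0 gD]; exists (C * D) => [|n]; first exact: mulr_ge0.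
by rewrite normrM exprD invfM mulrACA ler_pM.
Qed.

Lemma decaysZ (R : realType) (beta : R) (p : nat) (a : R) (f : R^nat) :
  decays beta p f -> decays beta p (fun n => a * f n).
Proof.
move=> [C C0 fC]; exists (`|a| * C) => [|n]; first exact: mulr_ge0.
by rewrite normrM -mulrA ler_wpM2l.
Qed.

Lemma decays_sum (R : realType) (beta : R) (p N : nat) (F : nat -> R^nat) :
  (forall j, (j < N)%N -> decays beta p (F j)) ->
  decays beta p (fun n => \sum_(j < N) F j n).
Proof.
elim: N => [|N IH] FN.
  by exists 0 => // n; rewrite big_ord0 normr0 mul0r.
apply: (@eq_decays _ _ _ (fun n => \sum_(j < N) F j n + F N n)).
  by move=> n; rewrite big_ord_recr.
by apply: decaysD; [apply: IH => j jN; apply: FN; exact: ltnW|exact: FN].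
Qed.

Lemma decays_shift (R : realType) (beta : R) (p : nat) (f : R^nat) :
  0 < beta -> decays beta p f -> decays beta p (fun n => f n.+1).
Proof.
move=> b0 [C C0 fC]; exists C => // n; apply: le_trans (fC _) _.
rewrite ler_wpM2l// lef_pV2 ?posrE ?exprn_gt0 ?node_gt0//.
by rewrite lerXn2r ?nnegrE ?(ltW (node_gt0 _ _))// lerD2l ler_nat.
Qed.

Lemma decays_le (R : realType) (beta : R) (p q : nat) (f : R^nat) :
  0 < beta -> (p <= q)%N -> decays beta q f -> decays beta p f.
Proof.
move=> b0 pq [C C0 fC].
(* The surplus power is largest at the smallest node, [beta]. *)
exists (C * beta ^- (q - p)) => [|n].
  by rewrite mulr_ge0// invr_ge0 exprn_ge0// ltW.
apply: le_trans (fC _) _.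
rewrite -mulrA ler_wpM2l// -invfM.
rewrite lef_pV2 ?posrE ?mulr_gt0 ?exprn_gt0 ?node_gt0//.
rewrite -{2}(subnK pq) exprD ler_wpM2r ?exprn_ge0 ?(ltW (node_gt0 _ _))//.
by rewrite lerXn2r ?nnegrE ?(ltW (node_gt0 _ _)) ?(ltW b0)// lerDl.
Qed.

Lemma decays_iter_fdiff (R : realType) (beta : R) (p k : nat) (f : R^nat) :
  0 < beta -> decays beta p f -> decays beta p (iter k (@fdiff R) f).
Proof.
move=> b0 fp; elim: k => //= k IH.
apply: (@eq_decays _ _ _ (fun n => iter k (@fdiff R) f n.+1 +
  -1 * iter k (@fdiff R) f n)) => [n|]; first by rewrite /fdiff mulN1r.
by apply: decaysD; [exact: decays_shift|exact: decaysZ].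
Qed.

(** By the Leibniz rule one difference yields two products, each of total order [p + q + 1]. The
    orders and both factors therefore vary in the induction on [k]. *)
Lemma diff_decaysM (R : realType) (beta : R) (p q : nat) (f g : R^nat) :
  0 < beta -> diff_decays beta p f -> diff_decays beta q g ->
  diff_decays beta (p + q) (fun n => f n * g n).
Proof.
move=> b0 + + k.
elim: k p q f g => [|k IH] p q f g fp gq.
  by have := decaysM (fp 0%N) (gq 0%N); rewrite !addn0.
apply: (@eq_decays _ _ _ (fun n =>
    iter k (@fdiff R) (fun m => fdiff f m * g m) n +
    iter k (@fdiff R) (fun m => f m.+1 * fdiff g m) n)) => [n|].
  rewrite -iter_fdiffD iterSr; apply: eq_iter_fdiff => m.
  by rewrite fdiffM.
have D u r : diff_decays beta r u -> diff_decays beta r.+1 (fdiff u).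
  by move=> ur j; rewrite -iterSr addSnnS; exact: ur.
apply: decaysD.
  by rewrite addnS -addSn -addSn; apply: IH => //; exact: D.
rewrite addnS -addSn -addnS; apply: IH; last exact: D.
move=> j; apply: (@eq_decays _ _ _ (fun n => iter j (@fdiff R) f n.+1)).
  by move=> n; rewrite iter_fdiff_shift.
by apply: decays_shift.
Qed.

(** * Differences of inverse powers *)

(** Reciprocal rising factorials are to differences what inverse powers are to derivatives: one
    difference lengthens the product by a factor and multiplies it by [- p]. *)
Lemma iter_fdiff_inv_rising (R : realType) (beta : R) (k p : nat) :
  0 < beta ->
  exists a, forall n,
    iter k (@fdiff R) (fun m => \prod_(i < p) (beta + (m + i)%:R)^-1) n =
    a * \prod_(i < p + k) (beta + (n + i)%:R)^-1.
Proof.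
move=> b0; elim: k p => [|k IH] p.
  by exists 1 => n; rewrite mul1r addn0.
have [a aP] := IH p.+1; exists (- p%:R * a) => n.
rewrite iterSr (@eq_iter_fdiff _ _ _ (fun m =>
  - p%:R * \prod_(i < p.+1) (beta + (m + i)%:R)^-1)).
  by rewrite iter_fdiffZ aP mulrA addnS addSn.
move=> m; rewrite /fdiff.
case: p {IH a aP} => [|p]; first by rewrite !big_ord0 subrr oppr0 mul0r.
rewrite big_ord_recr [in X in - X]big_ord_recl big_ord_recl big_ord_recr /=.
(* [P] is common to the products at [m] and [m.+1]; only their end factors differ. *)
set P := \prod_(i < p) (beta + (m.+1 + i)%:R)^-1.
have -> : \prod_(i < p) (beta + (m + bump 0 i)%:R)^-1 = P.
  by apply: eq_bigr => i _; rewrite /bump leq0n add1n addnS addSn.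
rewrite /bump leq0n add1n addn0.
have := node_gt0 m b0; have := node_gt0 (m + p.+1) b0.
rewrite addSnnS natrD -(natr1 p) => /lt0r_neq0 h1 /lt0r_neq0 h2.
by field; rewrite h1 h2.
Qed.

(** This is the rising factorial of length 1; after [k] differences each of the [1 + k] factors is
    at most [(beta + n)^-1]. *)
Lemma diff_decays_inv (R : realType) (beta : R) :
  0 < beta -> diff_decays beta 1 (fun n => (beta + n%:R)^-1).
Proof.
move=> b0 k; have [a aP] := iter_fdiff_inv_rising k 1 b0.
apply: (@eq_decays _ _ _
    (fun n => a * \prod_(i < 1 + k) (beta + (n + i)%:R)^-1)).
  move=> n; rewrite -aP; apply: eq_iter_fdiff => m.
  by rewrite big_ord_recl big_ord0 mulr1 addn0.
apply: decaysZ; exists 1 => // n; rewrite mul1r normr_prod.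
rewrite -exprVn -[X in _ <= _ ^+ X]card_ord -prodr_const.
apply: ler_prod => i _; rewrite normr_ge0 /= normfV gtr0_norm ?node_gt0//.
by rewrite lef_pV2 ?posrE ?node_gt0// lerD2l ler_nat leq_addr.
Qed.

Lemma diff_decays_invX (R : realType) (beta : R) (m : nat) :
  0 < beta -> diff_decays beta m.+1 (fun n => (beta + n%:R) ^- m.+1).
Proof.
move=> b0; elim: m => [|m IH] k.
  exact: diff_decays_inv.
apply: (@eq_decays _ _ _ (iter k (@fdiff R)
    (fun n => (beta + n%:R)^-1 * (beta + n%:R) ^- m.+1))).
  by apply: eq_iter_fdiff => n; rewrite -invfM -exprS.
by rewrite -add1n; apply: diff_decaysM => //; exact: diff_decays_inv.
Qed.

(** * Remainders of inverse power series *)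

Lemma sum_geometric_le (R : realFieldType) (q : R) (N d : nat) :
  0 <= q < 1 -> \sum_(N <= j < N + d) q ^+ j <= q ^+ N / (1 - q).
Proof.
move=> /andP[q0 q1]; rewrite ler_pdivlMr ?subr_gt0//.
suff <- : (\sum_(N <= j < N + d) q ^+ j) * (1 - q) + q ^+ (N + d) = q ^+ N.
  by rewrite lerDl exprn_ge0.
elim: d => [|d IH]; first by rewrite addn0 big_geq// mul0r add0r.
rewrite addnS big_nat_recr ?leq_addr//= -IH exprS; ring.
Qed.

(* Convergence at the smallest node forces [c j = O(beta ^ j)]; at every later
   node the series is then dominated by a geometric one. *)
Lemma decays_inv_power_series_remainder (R : realType) (beta : R) (c r : R^nat)
    (N : nat) :
  0 < beta ->
  (forall n, series (fun j => c j / (beta + n%:R) ^+ j) @ \oo --> r n) ->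
  decays beta N (fun n => r n - \sum_(j < N) c j / (beta + n%:R) ^+ j).
Proof.
move=> b0 hr.
have [M M0 cM] : exists2 M, 0 < M & forall j, `|c j| <= M * beta ^+ j.
  have /cvg_series_bounded/pinfty_ex_gt0[M M0 cM] : cvgn
      (series (fun j => c j / (beta + 0%:R) ^+ j)).
    by apply/cvg_ex; exists (r 0%N); exact: hr.
  exists M => // j; have := cM j I.
  rewrite /= addr0 normrM normfV (ger0_norm (exprn_ge0 _ (ltW b0))).
  by rewrite ler_pdivrMr ?exprn_gt0.
set f := fun n => _.
(* The first summand serves [n >= 1]. The second serves [n = 0], where the ratio [beta / x] is 1 and
   no geometric bound is available. *)
exists (M * beta ^+ N * (1 + beta) + `|f 0%N| * beta ^+ N) => [|n].
  by rewrite addr_ge0// !mulr_ge0 ?exprn_ge0 ?addr_ge0// ltW.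
have [->|n0] := eqVneq n 0%N.
  rewrite addr0 mulrDl mulfK ?expf_neq0 ?gt_eqF// lerDr.
  by rewrite !mulr_ge0 ?invr_ge0 ?exprn_ge0 ?addr_ge0// ltW.
have n1 : 1 <= n%:R :> R by rewrite ler1n lt0n.
set x := beta + n%:R; have x0 : 0 < x by exact: node_gt0.
rewrite mulrDl -[leLHS]addr0 lerD//; last first.
  by rewrite !mulr_ge0 ?invr_ge0 ?exprn_ge0// ltW.
have q01 : 0 <= beta / x < 1.
  by rewrite divr_ge0 ?ltW// ltr_pdivrMr// mul1r ltrDl; lra.
(* The left side is [x / n = 1 + beta / n], which gives a bound independent of [n >= 1]. *)
have qle : (1 - beta / x)^-1 <= 1 + beta.
  have nx : 1 - beta / x = n%:R / x.
    by rewrite /x; field; rewrite gt_eqF.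
  rewrite nx invf_div ler_pdivrMr; last by lra.
  have : 0 < beta * n%:R by apply: mulr_gt0 => //; lra.
  have : 0 <= beta * (n%:R - 1) by apply: mulr_ge0; lra.
  rewrite /x; lra.
have fcvg : (fun J => `|series (fun j => c j / x ^+ j) J -
    \sum_(j < N) c j / x ^+ j|) @ \oo --> `|f n|.
  by apply: cvg_norm; apply: cvgB; [exact: hr|exact: cvg_cst].
apply: (cvgr_to_le fcvg); near=> J.
have NJ : (N <= J)%N by near: J; exact: nbhs_infty_ge.
rewrite -(big_mkord xpredT (fun j => c j / x ^+ j)).
rewrite sub_series_geq// -(subnKC NJ).
apply: le_trans (ler_norm_sum _ _ _) _.
apply: (@le_trans _ _ (\sum_(N <= j < N + (J - N)) M * (beta / x) ^+ j)).
  apply: ler_sum => j _.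
  rewrite normrM normfV (ger0_norm (exprn_ge0 _ (ltW x0))) exprMn exprVn mulrA.
  by rewrite ler_wpM2r// invr_ge0 exprn_ge0// ltW.
rewrite -mulr_sumr.
apply: (@le_trans _ _ (M * ((beta / x) ^+ N / (1 - beta / x)))).
  by rewrite ler_wpM2l ?(ltW M0)// sum_geometric_le.
rewrite exprMn exprVn.
have -> : M * beta ^+ N * (1 + beta) / x ^+ N =
  M * (beta ^+ N / x ^+ N * (1 + beta)) by ring.
rewrite ler_wpM2l ?(ltW M0)// ler_wpM2l// divr_ge0// exprn_ge0// ltW.
Unshelve. all: by end_near. Qed.

(** * The numerator of the error *)

Lemma decays_iter_fdiff_levin_numerator (R : realType) (beta : R)
    (c r : R^nat) (k : nat) :
  0 < beta ->
  (forall n, series (fun j => c j / (beta + n%:R) ^+ j) @ \oo --> r n) ->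
  decays beta k.+2
    (iter k.+1 (@fdiff R) (fun n => (beta + n%:R) ^+ k * r n)).
Proof.
move=> b0 hr.
pose x (n : nat) : R := beta + n%:R.
have x0 n : x n != 0 by rewrite gt_eqF ?node_gt0.
(* With [2 * (k + 1)] terms removed, the remainder times [x ^+ k] is of order [x ^- (k + 2)], so
   differencing it need not gain anything. *)
pose rem n := r n - \sum_(j < k.+1 + k.+1) c j / x n ^+ j.
have remP : decays beta (k.+1 + k.+1) rem.
  exact: decays_inv_power_series_remainder.
apply: (@eq_decays _ _ _ (fun n =>
    iter k.+1 (@fdiff R)
      (fun m => \sum_(i < k.+1) c (k.+1 + i)%N * x m ^- i.+1) n +
    iter k.+1 (@fdiff R) (fun m => x m ^+ k * rem m) n)) => [n|]; last first.
  apply: decaysD.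
    apply: (@eq_decays _ _ _ (fun n => \sum_(i < k.+1)
        c (k.+1 + i)%N * iter k.+1 (@fdiff R) (fun m => x m ^- i.+1) n)).
      move=> n; rewrite (iter_fdiff_sum _ _
        (fun i m => c (k.+1 + i)%N * x m ^- i.+1)).
      by apply: eq_bigr => i _; rewrite iter_fdiffZ.
    apply: (@decays_sum _ _ _ _ (fun i n => c (k.+1 + i)%N *
      iter k.+1 (@fdiff R) (fun m => x m ^- i.+1) n)) => i _.
    (* The order is [i.+1 + k.+1], hence at least [k.+2]; the worst case is [i = 0]. *)
    apply: decaysZ; apply: decays_le (diff_decays_invX i b0 k.+1) => //.
    by rewrite addSn addnS !ltnS leq_addl.
  apply: decays_iter_fdiff => //; have [C C0 remC] := remP.
  exists C => // n; rewrite normrM ger0_norm ?exprn_ge0 ?(ltW (node_gt0 _ _))//.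
  rewrite -ler_pdivlMl ?exprn_gt0 ?node_gt0//.
  apply: le_trans (remC n) _.
  rewrite (_ : (k.+1 + k.+1)%N = (k + k.+2)%N) ?addSnnS// exprD invfM.
  by rewrite mulrCA.
(* The polynomial part, of degree at most [k], is put back at no cost: [k.+1] differences annihilate
   it. *)
transitivity (iter k.+1 (@fdiff R) (fun m =>
    \sum_(j < k.+1) c j * x m ^+ (k - j)) n +
  (iter k.+1 (@fdiff R)
    (fun m => \sum_(i < k.+1) c (k.+1 + i)%N * x m ^- i.+1) n +
   iter k.+1 (@fdiff R) (fun m => x m ^+ k * rem m) n)).
  rewrite (iter_fdiff_sum _ _ (fun j m => c j * x m ^+ (k - j))) big1 ?add0r//.
  move=> j _; rewrite iter_fdiffZ iter_fdiff_exp_eq0 ?mulr0//.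
  by rewrite ltnS leq_subr.
rewrite -!iter_fdiffD; apply: eq_iter_fdiff => m.
rewrite /rem big_split_ord /=.
have -> : \sum_(j < k.+1) c j * x m ^+ (k - j) =
    x m ^+ k * \sum_(j < k.+1) c j / x m ^+ j.
  rewrite mulr_sumr; apply: eq_bigr => j _.
  by rewrite mulrCA expfB_cond// (negbTE (x0 m)) add0n -ltnS.
have -> : \sum_(i < k.+1) c (k.+1 + i)%N * x m ^- i.+1 =
    x m ^+ k * \sum_(i < k.+1) c (k.+1 + i)%N / x m ^+ (k.+1 + i).
  rewrite mulr_sumr; apply: eq_bigr => i _.
  by rewrite mulrCA addSnnS exprD invfM mulVKf ?expf_neq0.
ring.
Qed.

(** * The error of the transformation and the order estimate *)

(** The constant [s] is itself a quotient over the same denominator, so linearity moves it into the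
    numerator. At order [k.+1] the integer exponent becomes the natural number [k]. *)
Lemma levin_errorE (R : realType) (k n : nat) (beta s : R) (s_ w : R^nat) :
  iter k.+1 (@fdiff R) (fun m => (beta + m%:R) ^+ k / w m) n != 0 ->
  levin k.+1 n beta s_ w - s =
  iter k.+1 (@fdiff R)
    (fun m => (beta + m%:R) ^+ k * ((s_ m - s) / w m)) n /
  iter k.+1 (@fdiff R) (fun m => (beta + m%:R) ^+ k / w m) n.
Proof.
move=> D0.
have -> : levin k.+1 n beta s_ w =
  iter k.+1 (@fdiff R) (fun m => (beta + m%:R) ^+ k * s_ m / w m) n /
  iter k.+1 (@fdiff R) (fun m => (beta + m%:R) ^+ k / w m) n.
  by rewrite /levin -addn1 PoszD addrK addn1.
rewrite -[s in LHS](mulfK D0) -mulrBl -mulN1r mulrA -iter_fdiffZ -iter_fdiffD.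
congr (_ / _); apply: eq_iter_fdiff => m; ring.
Qed.

Lemma strictly_alternating_inv_weight (R : realType) (w u : R^nat) :
  (forall n, 0 < u n) -> strictly_alternating w ->
  strictly_alternating (fun n => u n / w n).
Proof.
by move=> u0 wa n; rewrite !sgrM !sgrV !(gtr0_sg (u0 _)) !mul1r.
Qed.

(* hc0 makes w n a genuine estimate of the remainder s_ n - s, that is,
   (s_ n - s) / w n tends to a nonzero constant; the estimate fails for
   c 0 = 0, e.g. k = 1, beta = 1, s = 0, w n = (-1)^n, s_ n = (-1)^n/(n+1). *)
Theorem mainTheorem4 (R : realType) (summed_to : R^nat -> R -> Prop)
  (a s_ w c : R^nat) (s beta : R) (k : nat)
  (hpartial : forall n : nat, s_ n = \sum_(0 <= j < n.+1) a j)
  (hsum : limit_or_antilimit summed_to a s)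
  (hw0 : forall n : nat, w n != 0)
  (hw : strictly_alternating w)
  (hbeta : 0 < beta)
  (hexp : forall n : nat,
     series (fun j : nat => c j / (beta + n%:R) ^+ j) @ \oo
       --> (s_ n - s) / w n)
  (hc0 : c 0%N != 0)
  (hk : (0 < k)%N) :
  (fun n : nat => (levin k n beta s_ w - s) / (s_ n - s) : R)
    =O_\oo (fun n : nat => n%:R ^- (2 * k)%N : R).

Proof.
case: k hk => // k _.
pose x (n : nat) : R := beta + n%:R.
have x0 n : 0 < x n by exact: node_gt0.
have [C C0 numC] := decays_iter_fdiff_levin_numerator k hbeta hexp.
(* Splitting off only [c 0] leaves [(s_ n - s) / w n = c 0 + O(1 / x n)]. *)
have [D D0 remD] := decays_inv_power_series_remainder 1 hbeta hexp.
pose den := iter k.+1 (@fdiff R) (fun m => x m ^+ k / w m).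
have den_ge n : x n ^+ k / `|w n| <= `|den n|.
  rewrite -[x n ^+ k]gtr0_norm ?exprn_gt0// -normfV -normrM.
  apply: (@le_norm_iter_fdiff _ (fun m => x m ^+ k / w m)).
  by apply: strictly_alternating_inv_weight => // m; exact: exprn_gt0.
have den_gt0 n : 0 < `|den n|.
  by apply: lt_le_trans (den_ge n); rewrite divr_gt0 ?exprn_gt0 ?normr_gt0.
have c00 : 0 < `|c 0%N| by rewrite normr_gt0.
(* The factor [2 / |c 0|] comes from the lower bound on [|s_ n - s|]; [C + 1] keeps the constant
   positive when [C = 0]. *)
apply/eqO_exP; exists (2 * (C + 1) / `|c 0%N|).
  by rewrite divr_gt0// mulr_gt0// ltr_wpDl.
near=> n.
(* At [n = 0] the comparison term would be 0, as the inverse of 0 is 0. *)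
have n0 : 0 < n%:R :> R by near: n; exact: nbhs_infty_gtr.
(* Once [n] exceeds [D / (|c 0| / 2)], the ratio [(s_ n - s) / w n] is within [|c 0| / 2] of
   [c 0]. *)
have sn_ge : `|c 0%N| / 2 * `|w n| <= `|s_ n - s|.
  rewrite -ler_pdivlMr ?normr_gt0// -normfV -normrM.
  have : D * (x n)^-1 <= `|c 0%N| / 2.
    rewrite ler_pdivrMr// mulrC -ler_pdivrMr ?divr_gt0//.
    apply: (@le_trans _ _ n%:R); last by rewrite lerDr ltW.
    by near: n; exact: nbhs_infty_ger.
  have := remD n; rewrite big_ord1 expr0 divr1 expr1 -/(x n).
  have := ler_normD ((s_ n - s) / w n) (c 0%N - (s_ n - s) / w n).
  rewrite addrC subrK distrC; lra.
have num_le : `|levin k.+1 n beta s_ w - s| <= C * x n ^- k.+2 / `|den n|.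
  rewrite levin_errorE -?normr_gt0//.
  by rewrite normrM normfV ler_wpM2r ?invr_ge0 ?numC.
have w0 : 0 < `|w n| by rewrite normr_gt0.
(* The unknown size of [w n] cancels between the two lower bounds. *)
have prod_ge : x n ^+ k * (`|c 0%N| / 2) <= `|den n| * `|s_ n - s|.
  have -> : x n ^+ k * (`|c 0%N| / 2) =
      x n ^+ k / `|w n| * (`|c 0%N| / 2 * `|w n|) by field; rewrite gt_eqF.
  by rewrite ler_pM// ?mulr_ge0 ?divr_ge0 ?invr_ge0 ?exprn_ge0// ltW.
have sn0 : 0 < `|s_ n - s|.
  by apply: lt_le_trans sn_ge; rewrite mulr_gt0// divr_gt0.
rewrite normrM normfV (ger0_norm (x := n%:R ^- _)) ?invr_ge0 ?exprn_ge0//.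
apply: (@le_trans _ _ (C * x n ^- k.+2 / (x n ^+ k * (`|c 0%N| / 2)))).
  rewrite ler_pdivrMr//; apply: le_trans num_le _.
  rewrite -[leRHS]mulrA; apply: ler_wpM2l.
    by rewrite mulr_ge0// invr_ge0 exprn_ge0// ltW.
  rewrite mulrC ler_pdivlMr ?mulr_gt0 ?exprn_gt0 ?divr_gt0//.
  by rewrite mulrC ler_pdivrMr// [leRHS]mulrC.
have -> : C * x n ^- k.+2 / (x n ^+ k * (`|c 0%N| / 2)) =
    2 * C / `|c 0%N| * x n ^- (2 * k.+1).
  rewrite (_ : (2 * k.+1)%N = (k.+2 + k)%N); last by lia.
  by rewrite exprD; field; rewrite !gt_eqF ?exprn_gt0.
apply: ler_pM.
- by rewrite divr_ge0// mulr_ge0.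
- by rewrite invr_ge0 exprn_ge0// ltW.
- by rewrite ler_wpM2r ?invr_ge0// ler_wpM2l// lerDl.
(* Finally [n <= x n] replaces powers of the node by powers of [n]. *)
rewrite lef_pV2 ?posrE ?exprn_gt0//.
by rewrite lerXn2r ?nnegrE ?(ltW (x0 _)) ?(ltW n0)// lerDr ltW.
Unshelve. all: by end_near. Qed.
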